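(* The minimal clusters in $\Omega_3^{N,1}$ are exactly the following, with $m\ge 0$: \begin{itemize} \item for $i=1,2$, $\gamma_7$-chains of the form $\gamma_i-(\gamma_7)^m-\gamma_j$, where $j=i$ if $m$ is even and $j=i+3$ if $m$ is odd; \item for $i=3$, $\gamma_7$-chains of the form $\gamma_i-(\gamma_7)^m-\gamma_j$, where $j=i$ if $m\ge 2$ is even and $j=i+3$ if $m$ is odd; \item pure $\gamma_7$-clusters (trapezohedron) and the isolated types $\gamma_8$ and $\gamma_9$. \end{itemize}
   Context: All spaces are those of the path complex of a simple digraph $G=(V,E)$ (finite vertex set, no multiple edges, no loops), with $N\ge 2$. Let $\xi\in\mathbb{C}$ be a primitive $N$-th root of unity. An elementary $p$-path is a sequence of $p+1$ vertices, written $e_{i_0,\dots,i_p}$; it is regular if consecutive vertices differ, and allowed if each $(i_k,i_{k+1})$ is an edge of $G$. $\mathcal{A}_n$ is the $\mathbb{C}$-span of the allowed elementary $n$-paths. The (regular) boundary operator is $\partial(e_{i_0,\dots,i_p})=\sum_{j=0}^p\xi^j e_{i_0,\dots,\widehat{i_j},\dots,i_p}$, with irregular paths on the right set to $0$. $\Omega_3^{N,1}=\{v\in\mathcal{A}_3\mid\partial v\in\mathcal{A}_2\}$. An $(a,b)$-cluster is a path all of whose elementary paths with nonzero coefficient (its components) start at $a$ and end at $b$; a cluster is an $(a,b)$-cluster for some vertices $a,b$. An element of $\Omega_3^{N,1}$ is minimal if no sub linear combination of its components is in $\Omega_3^{N,1}$. For $v=e_{i,j,k,l}\in\mathcal{A}_3$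 the image-type is $\phi(v)=(\phi(e_{j,k,l}),\phi(e_{i,k,l}),\phi(e_{i,j,l}),\phi(e_{i,j,k}))$, where each entry records the type of the corresponding $2$-path: $T$ = triangle, $S$ = square, $W$ = admissible, $N_w$ = non-admissible. Here $e_{x,y,z}$ is non-admissible if it is not allowed; an allowed $e_{x,y,z}$ is of triangle type if $(x,z)$ is an edge, of square type if $(x,z)$ is not an edge and there is another allowed $2$-path $e_{x,y',z}$ with $y'\ne y$, and of type $W$ (only admissible) if $(x,z)$ is not an edge and there is no other allowed $2$-path from $x$ to $z$. The component types are labelled $\gamma_1=(S,T,N_w,T)$, $\gamma_2=(S,S,N_w,T)$, $\gamma_3=(S,W,N_w,T)$, $\gamma_4=(T,N_w,T,S)$, $\gamma_5=(T,N_w,S,S)$, $\gamma_6=(T,N_w,W,S)$, $\gamma_7=(S,N_w,N_w,S)$, $\gamma_8=(T,S,S,T)$, $\gamma_9=(T,T,T,T)$. Two components are one-step connectable if they share an $N_w$ face and a linear combination of the two cancels that $N_w$ face. A chain $\gamma_i-(\gamma_7)^m-\gamma_j$ is a cluster whose components form a sequence, successive ones being one-step connected, with end components of types $\gamma_i$ and $\gamma_j$ and $m$ intermediate components of type $\gamma_7$. The trapezohedron $T_r$ ($r\ge 2$) is built from the $3$-paths $e_{a,j_t,k_t,b}$ and $e_{a,j_{t+1},k_t,b}$ for all $t=0,\dots,r-1$, indices mod $r$.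
   Formalization: G is assumed to have no antiparallel edges (else e_{i,j,i,j} is an unlisted minimal cluster); for even m the mirror chains with both ends γ_{i+3} are added, as they occur but are omitted; the N_w faces cancelled along a chain are taken distinct. *)

(* Defs.v *)
From HB Require Import structures.
From mathcomp Require Import all_boot all_order all_algebra.
From mathcomp Require Import reals complex.
Set Implicit Arguments. Unset Strict Implicit. Unset Printing Implicit Defensive.
Import Order.TTheory GRing.Theory Num.Theory.
Local Open Scope ring_scope.

(* "No multiple edges" is read as: at most one edge between two vertices, so    *)
(* that antiparallel pairs x -> y -> x are excluded.                            *)
Definition simple_digraph (V : finType) (e : rel V) : Prop :=
  irreflexive e /\ (forall x y : V, e x y -> ~~ e y x).

(* The elementary n-path e_{i_0,...,i_n} is the (n+1)-tuple of its vertices,    *)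
(* and an n-path is given by its coefficients on elementary n-paths.            *)
Notation paths C V n := {ffun n.+1.-tuple V -> C^o}.

Section Paths.
Variables (C : fieldType) (V : finType) (e : rel V).

Definition regular n (t : n.-tuple V) : bool := sorted [rel x y | x != y] t.

Definition allowed n (t : n.-tuple V) : bool := sorted e t.

Definition face n (j : 'I_n.+1) (t : n.+1.-tuple V) : n.-tuple V :=
  [tuple tnth t (lift j i) | i < n].

Definition elem n (t : n.+1.-tuple V) : paths C V n := [ffun s => (s == t)%:R].

Definition components n (v : paths C V n) : {set n.+1.-tuple V} :=
  [set t | v t != 0].

Definition boundary_elem (xi : C) n (t : n.+2.-tuple V) : paths C V n :=
  \sum_(j < n.+2 | regular (face j t)) xi ^+ j *: elem (face j t).

Definition boundary (xi : C) n (v : paths C V n.+1) : paths C V n :=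
  \sum_t v t *: boundary_elem xi t.

(* The spaces A_n and Omega_3^{N,1}. *)
Definition in_A n (v : paths C V n) : Prop :=
  forall t, t \in components v -> allowed t.

Definition in_Omega3 (xi : C) (v : paths C V 3) : Prop :=
  in_A v /\ in_A (boundary xi v).

Definition cluster n (v : paths C V n) : Prop :=
  exists a b : V, forall t, t \in components v ->
    thead t = a /\ tnth t ord_max = b.

(* A sub linear combination of the components of v is any nonzero combination,  *)
(* with arbitrary coefficients, of some but not all of them.                    *)
Definition minimal (xi : C) (v : paths C V 3) : Prop :=
  [/\ in_Omega3 xi v, v != 0 &
      forall u : paths C V 3, u != 0 -> components u \proper components v ->
        ~ in_Omega3 xi u].

(* Triangle, square, only admissible, non-admissible. *)
Inductive ptype : Set := tT | tS | tW | tN.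

Definition type2 (s : 3.-tuple V) : ptype :=
  let x := tnth s 0 in let y := tnth s 1 in let z := tnth s 2%:R in
  if ~~ allowed s then tN
  else if e x z then tT
  else if [exists y', [&& y' != y, e x y' & e y' z]] then tS
  else tW.

(* Deleting the vertices of e_{i,j,k,l} from the first to the last gives the    *)
(* faces in the order (jkl, ikl, ijl, ijk).                                     *)
Definition image_type (t : 4.-tuple V) : 4.-tuple ptype :=
  [tuple type2 (face j t) | j < 4].

Definition gamma (i : nat) : option (4.-tuple ptype) :=
  match i with
  | 1 => Some [tuple tS; tT; tN; tT]
  | 2 => Some [tuple tS; tS; tN; tT]
  | 3 => Some [tuple tS; tW; tN; tT]
  | 4 => Some [tuple tT; tN; tT; tS]
  | 5 => Some [tuple tT; tN; tS; tS]
  | 6 => Some [tuple tT; tN; tW; tS]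
  | 7 => Some [tuple tS; tN; tN; tS]
  | 8 => Some [tuple tT; tS; tS; tT]
  | 9 => Some [tuple tT; tT; tT; tT]
  | _ => None
  end.

Definition has_type (i : nat) (t : 4.-tuple V) : Prop :=
  gamma i = Some (image_type t).

(* The components p and q of v share the non-admissible face w, and their terms *)
(* in v cancel it.                                                              *)
Definition one_step (xi : C) (v : paths C V 3) (p q : 4.-tuple V)
    (w : 3.-tuple V) : Prop :=
  [/\ p != q, type2 w = tN,
      exists j : 'I_4, face j p = w, exists j : 'I_4, face j q = w &
      boundary xi (v p *: elem p + v q *: elem q) w = 0].

(* gamma_i - (gamma_7)^m - gamma_j.  The shared faces are pairwise distinct:    *)
(* a sequence which comes back to an already cancelled face is not minimal.     *)
Definition gamma7_chain (xi : C) (v : paths C V 3) (i m j : nat) : Prop :=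
  cluster v /\
  exists (p : 'I_m.+2 -> 4.-tuple V) (w : 'I_m.+1 -> 3.-tuple V),
    [/\ injective p /\ components v =i codom p,
        has_type i (p ord0),
        forall s, s != ord0 -> s != ord_max -> has_type 7 (p s),
        has_type j (p ord_max) &
        injective w /\
        forall s : 'I_m.+1,
          one_step xi v (p (widen_ord (leqnSn m.+1) s)) (p (lift ord0 s)) (w s)].

(* A multiple of T_r, all of whose components have type gamma_7; ordS is the    *)
(* successor modulo r.                                                          *)
Definition trapezohedron (v : paths C V 3) : Prop :=
  exists (r : nat) (a b : V) (j k : 'I_r -> V) (c : C),
    [/\ (2 <= r)%N, injective j /\ injective k, c != 0,
        v = c *: \sum_(t < r) (elem [tuple a; j t; k t; b]
                               - elem [tuple a; j (ordS t); k t; b]) &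
        forall t, t \in components v -> has_type 7 t].

Definition isolated (i : nat) (v : paths C V 3) : Prop :=
  exists2 t : 4.-tuple V, components v = [set t] & has_type i t.

End Paths.

(* Main.v *)
(* For an (a,b)-cluster v in A_3, the only faces of a component (a,j,k,b) that can
   be non-allowed are (a,k,b) (when a -> k is not an edge) and (a,j,b) (when j -> b
   is not an edge), and a non-allowed triple (a,x,b) cannot arise in both ways.  So
   v is in Omega_3 exactly when the coefficients of the components through each
   such triple sum to zero.  View each component as an edge joining its non-allowed
   faces, with a common ground vertex standing for the allowed ones: minimal
   clusters are then the circuits of a graph that is bipartite apart from the
   ground, i.e. loops at the ground (gamma_8, gamma_9), closed walks through the
   ground (the gamma_7-chains) and even cycles avoiding it (trapezohedra).  Both
   ends of a chain have an allowed face (a,x,b), and the type of such a face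
   depends only on a and b. *)
Require Import Defs.
From HB Require Import structures.
From mathcomp Require Import all_boot all_order all_algebra.
From mathcomp Require Import reals complex zify.
Set Implicit Arguments. Unset Strict Implicit. Unset Printing Implicit Defensive.
Import Order.TTheory GRing.Theory Num.Theory.
Local Open Scope ring_scope.

Section Paths3.
Variables (C : fieldType) (V : finType) (e : rel V).
Implicit Types (u v : paths C V 3) (p q t : 4.-tuple V) (w : 3.-tuple V).

(** * Interior faces of a 3-path and image types *)

(** These are the only faces of an allowed path that can fail to be allowed. With a boolean index,
    alternating between them along a walk becomes addition of parities. *)
Definition sface (b : bool) t : 3.-tuple V := face (if b then 1 else 2%:R : 'I_4) t.

Lemma tuple4P t : exists i j k l, t = [tuple i; j; k; l].
Proof.
exists (tnth t 0), (tnth t 1), (tnth t 2%:R), (tnth t 3%:R).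
apply: eq_from_tnth => i; rewrite [in RHS](tnth_nth (tnth t 0)).
by case: i => [[|[|[|[|//]]]] lti] /=; congr (tnth t _); apply: val_inj.
Qed.

Lemma face0E i j k l : face 0 [tuple i; j; k; l] = [tuple j; k; l] :> 3.-tuple V.
Proof. by apply: eq_from_tnth => -[[|[|[|//]]] lti]; rewrite tnth_mktuple !(tnth_nth i). Qed.

Lemma face1E i j k l : sface true [tuple i; j; k; l] = [tuple i; k; l].
Proof. by apply: eq_from_tnth => -[[|[|[|//]]] lti]; rewrite tnth_mktuple !(tnth_nth i). Qed.

Lemma face2E i j k l : sface false [tuple i; j; k; l] = [tuple i; j; l].
Proof. by apply: eq_from_tnth => -[[|[|[|//]]] lti]; rewrite tnth_mktuple !(tnth_nth i). Qed.

Lemma face3E i j k l : face 3%:R [tuple i; j; k; l] = [tuple i; j; k] :> 3.-tuple V.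
Proof. by apply: eq_from_tnth => -[[|[|[|//]]] lti]; rewrite tnth_mktuple !(tnth_nth i). Qed.

Lemma tuple3_inj (x y z x' y' z' : V) :
  [tuple x; y; z] = [tuple x'; y'; z'] -> [/\ x = x', y = y' & z = z'].
Proof. by move/(congr1 val) => /= -[-> -> ->]. Qed.

Lemma tuple4_inj (x y z s x' y' z' s' : V) :
  [tuple x; y; z; s] = [tuple x'; y'; z'; s'] -> [/\ x = x', y = y', z = z' & s = s'].
Proof. by move/(congr1 val) => /= -[-> -> -> ->]. Qed.

(** Face 1 forgets only the second vertex and face 2 only the third. In the graph of components this
    says that no two components join the same pair of interior faces. *)
Lemma sface_inj p q : (forall b, sface b p = sface b q) -> p = q.
Proof.
have [i [j [k [l ->]]]] := tuple4P p; have [i' [j' [k' [l' ->]]]] := tuple4P q => eq_f.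
have := eq_f true; have := eq_f false; rewrite !(face1E, face2E).
by case/tuple3_inj => -> -> -> /tuple3_inj[_ -> _].
Qed.

Lemma allowed3E i j k : allowed e [tuple i; j; k] = e i j && e j k.
Proof. by rewrite /allowed /= andbT. Qed.

Lemma allowed4E i j k l : allowed e [tuple i; j; k; l] = [&& e i j, e j k & e k l].
Proof. by rewrite /allowed /= andbT. Qed.

Lemma type2E i j k : type2 e [tuple i; j; k] =
  if ~~ (e i j && e j k) then tN else if e i k then tT
  else if [exists y', [&& y' != j, e i y' & e y' k]] then tS else tW.
Proof. by rewrite /type2 allowed3E !(tnth_nth i). Qed.

Lemma type2N w : type2 e w = tN <-> ~~ allowed e w.
Proof.
rewrite /type2; case: (allowed e w) => //=; split=> //.
by case: ifP => // _; case: ifP.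
Qed.

Lemma image_typeE t : image_type e t =
  [tuple type2 e (face 0 t); type2 e (sface true t); type2 e (sface false t);
         type2 e (face 3%:R t)].
Proof.
apply: eq_from_tnth => i; rewrite tnth_mktuple [in RHS](tnth_nth tT).
by case: i => [[|[|[|[|//]]]] lti] /=; congr (type2 e (face _ t)); apply: val_inj.
Qed.

Lemma has_typeE n (x y z s : ptype) t : gamma n = Some [tuple x; y; z; s] ->
  has_type e n t <-> [/\ type2 e (face 0 t) = x, type2 e (sface true t) = y,
    type2 e (sface false t) = z & type2 e (face 3%:R t) = s].
Proof.
move=> En; by rewrite /has_type En image_typeE; split=> [[]|[-> -> -> ->]].
Qed.

(** * Faces of allowed paths in a simple digraph *)

Hypothesis simple_e : simple_digraph e.

Lemma edge_neq x y : e x y -> x != y.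
Proof. by move=> exy; apply: contraTneq exy => ->; rewrite simple_e.1. Qed.

Lemma edge2_neq x y z : e x y -> e y z -> x != z.
Proof. by move=> exy; apply: contraTneq => <-; apply: simple_e.2. Qed.

(** Deleting an inner vertex brings together two vertices at distance two along the path; they
    differ because antiparallel edges are excluded. So no boundary term of an allowed path is
    dropped as irregular. *)
Lemma regular_face (j : 'I_4) t : allowed e t -> regular (face j t).
Proof.
have [x [y [z [s ->]]]] := tuple4P t; rewrite allowed4E => /and3P[exy eyz ezs].
have -> : j = inord j by rewrite inord_val.
case: j => [[|[|[|[|//]]]] ltj] /=.
- rewrite (_ : inord 0 = 0) ?face0E; last by apply: val_inj; rewrite /= inordK.
  by rewrite /regular /= !edge_neq.
- rewrite (_ : inord 1 = 1); last by apply: val_inj; rewrite /= inordK.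
  by rewrite -/(sface true _) face1E /regular /= (edge2_neq exy) ?edge_neq.
- rewrite (_ : inord 2 = 2%:R); last by apply: val_inj; rewrite /= inordK.
  by rewrite -/(sface false _) face2E /regular /= (edge2_neq eyz) ?edge_neq.
- rewrite (_ : inord 3 = 3%:R) ?face3E; last by apply: val_inj; rewrite /= inordK.
  by rewrite /regular /= !edge_neq.
Qed.

Lemma allowed_face03 t : allowed e t -> allowed e (face 0 t) /\ allowed e (face 3%:R t).
Proof.
have [x [y [z [s ->]]]] := tuple4P t; rewrite allowed4E => /and3P[exy eyz ezs].
by rewrite face0E face3E !allowed3E exy eyz.
Qed.

(** If [(x,z,y)] is face 1 of an allowed path, then [z -> y] is an edge; if it is face 2, then
    [x -> z] is an edge. Both together would make it allowed. This is the bipartition of the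
    non-allowed faces. *)
Lemma sface_side w b b' t t' : ~~ allowed e w -> allowed e t -> allowed e t' ->
  sface b t = w -> sface b' t' = w -> b = b'.
Proof.
have [x [y [z [s ->]]]] := tuple4P t; have [x' [y' [z' [s' ->]]]] := tuple4P t'.
rewrite !allowed4E => + /and3P[exy eyz ezs] /and3P[exy' eyz' ezs'].
case: b b' => -[] //; rewrite ?face1E ?face2E => + E E'.
  rewrite -E allowed3E ezs; case/tuple3_inj: (etrans E (esym E')) => -> -> _.
  by rewrite exy'.
rewrite -E allowed3E exy; case/tuple3_inj: (etrans E (esym E')) => _ -> ->.
by rewrite ezs'.
Qed.

(** * Membership in Omega as linear conditions at non-allowed faces *)

Definition nsum v b w : C := \sum_(t | sface b t == w) v t.

Lemma in_A_notin v t : in_A e v -> ~~ allowed e t -> v t = 0.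
Proof.
by move=> Av; apply: contraNeq => vt; apply: Av; rewrite inE.
Qed.

Variable xi : C.

(** Faces 0 and 3 of an allowed path are allowed, so only the terms with coefficients [xi] and
    [xi ^+ 2] can reach [w]. *)
Lemma boundary_nsum v w : in_A e v -> ~~ allowed e w ->
  boundary xi v w = xi * nsum v true w + xi ^+ 2 * nsum v false w.
Proof.
move=> Av Nw.
have nsum_if b : nsum v b w = \sum_t if sface b t == w then v t else 0 by apply: big_mkcond.
rewrite !nsum_if {nsum_if}.
rewrite /boundary sum_ffunE !mulr_sumr -big_split /=.
apply: eq_bigr => t _; rewrite !ffunE.
have [At|At] := boolP (allowed e t); last first.
  by rewrite (in_A_notin Av) // scale0r !if_same !mulr0 addr0.
rewrite sum_ffunE (eq_bigl _ _ (fun j => regular_face j At)).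
have [A0 A3] := allowed_face03 At.
have eq0 j : allowed e (face j t) -> (w == face j t) = false.
  by move=> Aj; apply: contraNF Nw => /eqP->.
rewrite !big_ord_recl big_ord0 !ffunE /= eq0 //.
rewrite (_ : lift ord0 ord0 = 1) ?[lift ord0 _]/=; last exact: val_inj.
rewrite (_ : lift ord0 _ = 2%:R) ?[lift ord0 _]/=; last exact: val_inj.
rewrite (_ : lift ord0 (lift ord0 (lift _ _)) = 3%:R); last exact: val_inj.
rewrite (eq0 3%:R) //= /sface !(eq_sym w).
rewrite /GRing.scale /= !mulr0 !(addr0, add0r) mulrDr expr1.
by congr (_ + _); case: eqP => _ /=; rewrite !(mulr0, mulr1) // mulrC.
Qed.


Lemma nsum_eq0 v b w : (forall t, t \in components v -> sface b t != w) -> nsum v b w = 0.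
Proof.
move=> vw; apply: big1 => t tw; apply/eqP; apply: contraT => vt.
by have := vw t; rewrite inE vt tw => /(_ isT).
Qed.

Hypothesis xi_neq0 : xi != 0.

(** By [sface_side], the components through a non-allowed [w] all lie on one side, so one of the two
    sums in [boundary_nsum] is empty and the other carries a nonzero power of [xi]. *)
Lemma in_Omega3P v : in_A e v ->
  in_Omega3 e xi v <-> forall b w, ~~ allowed e w -> nsum v b w = 0.
Proof.
move=> Av; split=> [[_ Bv] b w Nw | nsum0]; last first.
  split=> // w; rewrite inE; apply: contraR => Nw.
  by rewrite boundary_nsum // !nsum0 // !mulr0 addr0.
have [t /andP[tv /eqP tw]|nt] := pickP [pred t | (t \in components v) && (sface b t == w)].
  have other : nsum v (~~ b) w = 0.
    apply: nsum_eq0 => t' t'v; apply/eqP => t'w.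
    by have := sface_side Nw (Av _ tv) (Av _ t'v) tw t'w; case: (b).
  have /eqP : boundary xi v w = 0.
    by apply: contraNeq Nw => Bw; apply: Bv; rewrite inE.
  rewrite boundary_nsum //; case: b tw other => _ /= ->; rewrite mulr0 (addr0, add0r).
    by rewrite mulf_eq0 (negPf xi_neq0) => /eqP.
  by rewrite mulf_eq0 expf_eq0 (negPf xi_neq0) andbF => /eqP.
by apply: nsum_eq0 => t tv; have /= := nt t; rewrite tv /= => ->.
Qed.

Lemma in_A_sub u v : in_A e v -> components u \subset components v -> in_A e u.
Proof. by move=> Av /subsetP uv t /uv; apply: Av. Qed.

Lemma components_neq0 u : u != 0 -> exists t, t \in components u.
Proof.
move=> u0; have [t tu|nt] := pickP [pred t | t \in components u]; first by exists t.
case/eqP: u0; apply/ffunP => t; rewrite ffunE; have := nt t.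
by rewrite /= inE => /negbFE/eqP.
Qed.

(* Otherwise eliminating one component from [v] by means of [u] would give a
   smaller element of Omega. *)
Lemma minimal_proportional u v : minimal e xi v -> u != 0 -> in_Omega3 e xi u ->
  components u \subset components v -> exists2 c : C, c != 0 & forall t, v t = c * u t.
Proof.
move=> [Ov v0 vmin] u0 Ou uv; have [p pu] := components_neq0 u0.
have up : u p != 0 by rewrite inE in pu.
have vp : v p != 0 by have /(subsetP uv) := pu; rewrite inE.
pose c := v p / u p; pose d : paths C V 3 := [ffun t => v t - c * u t].
have dv : components d \subset components v.
  apply/subsetP => t; rewrite !inE ffunE; apply: contra => /eqP vt.
  have: t \notin components u by apply/negP => /(subsetP uv); rewrite inE vt eqxx.
  by rewrite inE negbK vt => /eqP->; rewrite mulr0 subr0.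
have [|d0] := eqVneq d 0.
  move/ffunP => d0; exists c => [|t]; first by rewrite mulf_neq0 ?invr_eq0.
  by have /eqP := d0 t; rewrite !ffunE subr_eq0 => /eqP.
case: (vmin d d0).
  apply/properP; split=> //; exists p; rewrite !inE ?ffunE //.
  by rewrite /c divfK // subrr eqxx.
have Av := Ov.1; have Ad := in_A_sub Av dv; apply/in_Omega3P => // b w Nw.
have -> : nsum d b w = nsum v b w - c * nsum u b w.
  rewrite /nsum mulr_sumr -sumrB; apply: eq_bigr => t _; exact: ffunE.
have /in_Omega3P -> // := Ov; have /in_Omega3P -> // := Ou; last exact: Ou.1.
by rewrite mulr0 subr0.
Qed.

Lemma elemE n (t s : n.+1.-tuple V) : @elem C V n t s = (s == t)%:R.
Proof. exact: ffunE. Qed.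

Lemma scale_pathE (a : C) u t : (a *: u) t = a * u t.
Proof. exact: ffunE. Qed.

Lemma nsumE v b w : nsum v b w = \sum_t v t * (sface b t == w)%:R.
Proof.
by rewrite /nsum big_mkcond; apply: eq_bigr => t _; case: eqP; rewrite (mulr1, mulr0).
Qed.

Lemma nsum_elem (a : C) p b w : nsum (a *: elem C p) b w = a * (sface b p == w)%:R.
Proof.
rewrite nsumE (bigD1 p) //= big1 ?addr0 => [|t /negPf tp]; last first.
  by rewrite scale_pathE elemE tp mulr0 mul0r.
by rewrite scale_pathE elemE eqxx mulr1.
Qed.

Lemma nsumD u v b w : nsum (u + v) b w = nsum u b w + nsum v b w.
Proof. by rewrite /nsum -big_split; apply: eq_bigr => t _; rewrite ffunE. Qed.

Lemma nsum_sum (I : Type) (r : seq I) (P : pred I) (F : I -> paths C V 3) b w :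
  nsum (\sum_(i <- r | P i) F i) b w = \sum_(i <- r | P i) nsum (F i) b w.
Proof.
apply: (big_morph (fun u => nsum u b w)) => [u v|]; first exact: nsumD.
by apply: big1 => t _; rewrite ffunE.
Qed.

(** * Walks along shared faces *)

(** If [p] were alone on this face, the sum there would be its nonzero coefficient. *)
Lemma partner v p b : in_Omega3 e xi v -> p \in components v ->
  ~~ allowed e (sface b p) ->
  exists q, [/\ q \in components v, q != p & sface b q = sface b p].
Proof.
move=> Ov pv Np; have [q /and3P[? ? /eqP ?]|nq] := pickP
  [pred q | [&& q \in components v, q != p & sface b q == sface b p]]; first by exists q.
have := (in_Omega3P Ov.1).1 Ov b _ Np; rewrite /nsum (bigD1 p) //= big1 ?addr0 => [vp|q].
  by rewrite inE vp eqxx in pv.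
case/andP=> pq qp; apply/eqP; apply: contraFT (nq q) => vq /=.
by rewrite inE vq qp pq.
Qed.

(* Consecutive components share alternately their faces 1 and 2, unless the walk
   is stuck at an allowed face, where it may stay put. *)
Definition walk v b (p : nat -> 4.-tuple V) : Prop :=
  [/\ forall s, p s \in components v,
      forall s, sface (b (+) odd s.+1) (p s) = sface (b (+) odd s.+1) (p s.+1) &
      forall s, ~~ allowed e (sface (b (+) odd s.+1) (p s.+1)) -> p s != p s.+1].

(** The face through which a walk enters [p s]; the walk leaves through the other interior face of
    [p s], which is the node at [s.+1]. *)
Definition node b (p : nat -> 4.-tuple V) s := sface (b (+) odd s) (p s).

Lemma walk_exists v b p0 : in_Omega3 e xi v -> p0 \in components v ->
  exists2 p : nat -> 4.-tuple V, p 0%N = p0 & walk v b p.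
Proof.
move=> Ov p0v; pose good b' p := [pred q | [&& q \in components v, q != p &
  sface b' q == sface b' p]].
(* The default [p] makes the walk stay put when no other component shares the face. *)
pose step b' p := odflt p [pick q | good b' p q].
pose p n := iteri n (fun s => step (b (+) odd s.+1)) p0.
exists p => //.
have stepv b' t : t \in components v -> step b' t \in components v.
  by rewrite /step; case: pickP => //= q /and3P[].
have stepf b' t : sface b' t = sface b' (step b' t).
  by rewrite /step; case: pickP => //= q /and3P[_ _ /eqP->].
have pv s : p s \in components v by elim: s => //= s IH; apply: stepv.
split=> [//|s|s]; first exact: (stepf (b (+) odd s.+1) (p s)).
rewrite -[p s.+1]/(step (b (+) odd s.+1) (p s)) -stepf => Nw; rewrite eq_sym.
have [q [qv qp qf]] := partner Ov (pv s) Nw.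
rewrite /step; case: pickP => [q' /and3P[] //|/(_ q)/negP[]] /=.
by apply/and3P; split=> //; apply/eqP.
Qed.

(** Take for [n] the first positive index whose node is allowed or repeats an earlier one of
    positive index. Index 0 is left out because a walk may start at an allowed face. *)
Lemma walk_event b (p : nat -> 4.-tuple V) : exists n, [/\ (0 < n)%N,
  allowed e (node b p n) \/ (exists2 r, (0 < r < n)%N & node b p r = node b p n),
  forall s, (0 < s < n)%N -> ~~ allowed e (node b p s) &
  forall s t : nat, (0 < s < n)%N -> (0 < t < n)%N -> node b p s = node b p t -> s = t].
Proof.
set z := node b p.
pose P n := (0 < n)%N &&
  (allowed e (z n) || [exists r : 'I_n, (0 < r)%N && (z r == z n)]).
have exP : exists n, P n.
  (* Pigeonhole: there are more indices than 3-tuples of vertices. *)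
  pose f (i : 'I_(#|{: 3.-tuple V}|.+1)) := z i.+1.
  have /injectivePn[i [j ij fij]] : ~~ injectiveb f.
    apply/injectiveP => /(@leq_card _ _ f).
    by rewrite card_ord ltnn.
  wlog ltij : i j ij fij / (i < j)%N.
    move=> W; case: (ltngtP i j) => [|lt|/val_inj eq]; first exact: W.
      by apply: (W j i) => //; rewrite eq_sym.
    by rewrite eq eqxx in ij.
  exists j.+1; rewrite /P; apply/orP; right; apply/existsP.
  by exists (Ordinal (ltij : i.+1 < j.+1)%N) => /=; rewrite -/(f i) fij.
case: (ex_minnP exP) => n /andP[n0 /orP Pn] nmin; exists n.
have Pf s : (0 < s < n)%N -> P s = false.
  by case/andP=> _ sn; apply: contraTF sn => /nmin; rewrite -leqNgt.
split=> // [|s sn|].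
- case: Pn => [->|/existsP[r /andP[r0 /eqP zr]]]; first by left.
  by right; exists r; rewrite ?r0 ?ltn_ord.
- have := Pf s sn; rewrite /P; case/andP: sn => -> _ /=.
  by move/negbT/norP => [].
have lt (s t : nat) : (0 < s)%N -> (0 < t < n)%N -> (s < t)%N -> z s <> z t.
  move=> s0 tn st zst; have := Pf t tn; rewrite /P; case/andP: tn => -> _ /=.
  move/negbT/norP => [_ /existsP]; apply; exists (Ordinal st) => /=; rewrite s0 zst eqxx //.
move=> s t sn tn zst; case: (ltngtP s t) => // st.
  by case/andP: sn => s0 _; case: (lt s t).
by case/andP: tn => t0 _; case: (lt t s).
Qed.

(** The signs make consecutive components cancel at the face they share. *)
Definition alternating (p : nat -> 4.-tuple V) n : paths C V 3 :=
  \sum_(s < n) (-1) ^+ s *: elem C (p s).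

Lemma alternatingE (p : nat -> 4.-tuple V) n s : {in gtn n &, injective p} -> (s < n)%N ->
  alternating p n (p s) = (-1) ^+ s.
Proof.
move=> pinj sn; rewrite /alternating sum_ffunE (bigD1 (Ordinal sn)) //= big1 => [|t ts].
  by rewrite scale_pathE elemE eqxx mulr1 addr0.
rewrite scale_pathE elemE; case: eqP => [/pinj E|_]; last exact: mulr0.
by case/eqP: ts; apply: val_inj; rewrite /= E ?inE.
Qed.

Lemma alternating_components (p : nat -> 4.-tuple V) n : {in gtn n &, injective p} ->
  components (alternating p n) =i [seq p s | s <- iota 0 n].
Proof.
move=> pinj t; apply/idP/idP => [|/mapP[s]]; last first.
  by rewrite mem_iota => /= sn ->; rewrite inE alternatingE // signr_eq0.
apply: contraTT => nt; rewrite inE negbK /alternating sum_ffunE big1 // => s _.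
rewrite scale_pathE elemE; case: eqP => [E|_]; last exact: mulr0.
by case/mapP: nt; exists (val s); rewrite // mem_iota ltn_ord.
Qed.

(* The sum telescopes along the nodes of the walk. *)
Lemma nsum_alternating v b (p : nat -> 4.-tuple V) n b' w : walk v b p ->
  let G s := (-1) ^+ s * ((b' == b (+) odd s) && (node b p s == w))%:R in
  nsum (alternating p n) b' w = G 0%N - G n.
Proof.
move=> [_ share _] G; rewrite /alternating nsum_sum -[RHS]opprB -telescope_sumr //.
rewrite big_mkord -sumrN; apply: eq_bigr => s _; rewrite nsum_elem opprB /G.
have [->|b'E] := eqVneq b' (b (+) odd s).
  have -> : (b (+) odd s == b (+) odd s.+1) = false.
    by rewrite oddS addbN; case: (b (+) odd s).
  by rewrite mulr0 subr0.
have -> : b' = b (+) odd s.+1 by rewrite oddS addbN; case: (b') (b (+) odd s) b'E => -[].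
by rewrite eqxx share exprS mulN1r mulNr opprK mulr0 add0r.
Qed.

(** Equal components at indices of equal parity have equal nodes. If [s < t] have opposite parity,
    the node at [t] is the face by which [p s] is left, so [t = s.+1]; but a walk does not stay put
    at a non-allowed face. *)
Lemma walk_inj v b (p : nat -> 4.-tuple V) r n : walk v b p ->
  (forall s, (r < s < n)%N -> ~~ allowed e (node b p s)) ->
  {in [pred s | (r <= s < n)%N] &, injective (node b p)} ->
  {in [pred s | (r <= s < n)%N] &, injective p}.
Proof.
move=> [_ share move_on] Nz zinj s t; wlog st : s t / (s < t)%N.
  move=> W sn tn pst; case: (ltngtP s t) => // lt; first exact: W.
  by apply/esym/W.
rewrite !inE => sn tn pst; have [odd_eq|odd_ne] := eqVneq (odd s) (odd t).
  by apply: zinj; rewrite // /node odd_eq pst.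
have ts : t = s.+1.
  apply: zinj => //; first by rewrite inE; lia.
  have -> : node b p s.+1 = sface (b (+) odd s.+1) (p s) by rewrite share.
  by rewrite /node pst oddS; case: (odd s) (odd t) odd_ne => -[].
have /move_on : ~~ allowed e (node b p s.+1) by apply: Nz; lia.
by rewrite -ts pst eqxx.
Qed.

Lemma in_Omega3_sub u v : in_Omega3 e xi v -> components u \subset components v ->
  (forall b w, ~~ allowed e w -> nsum u b w = 0) -> in_Omega3 e xi u.
Proof. by move=> [Av _] uv nu; apply/(in_Omega3P (in_A_sub Av uv)). Qed.

(** Only the two end nodes survive the telescoping, and being allowed they impose no condition. So
    the alternating sum lies in Omega, and minimality makes [v] a multiple of it. *)
Lemma walk_alternating v b (p : nat -> 4.-tuple V) n : minimal e xi v -> walk v b p ->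
  (0 < n)%N -> allowed e (node b p 0) -> allowed e (node b p n) ->
  (forall s, (0 < s < n)%N -> ~~ allowed e (node b p s)) ->
  {in [pred s | (0 < s < n)%N] &, injective (node b p)} ->
  {in gtn n &, injective p} /\
  exists2 c : C, c != 0 & forall t, v t = c * alternating p n t.
Proof.
move=> vmin wp n0 A0 An Nz zinj; have [Ov _ _] := vmin; have [pv _ _] := wp.
have pinj : {in gtn n &, injective p}.
  (* The start node is allowed and the later ones are not, so injectivity of the nodes extends to
     index 0. *)
  apply: (walk_inj wp Nz) => s t; rewrite !inE /=.
  case: (posnP s) (posnP t) => [->|s0] [->|t0] // sn tn zst.
  - by have := Nz t; rewrite t0 tn -zst A0 => /(_ isT).
  - by have := Nz s; rewrite s0 sn zst A0 => /(_ isT).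
  - by apply: zinj; rewrite ?inE ?s0 ?t0.
split=> //; apply: minimal_proportional => //.
- apply/eqP => /ffunP/(_ (p 0%N)); rewrite alternatingE // ffunE => /eqP.
  by rewrite oner_eq0.
- apply: (in_Omega3_sub Ov).
    apply/subsetP => t; rewrite alternating_components //.
    by case/mapP => s _ ->; exact: pv.
  move=> b' w Nw; rewrite (nsum_alternating _ _ _ wp).
  have zF s : allowed e (node b p s) -> (node b p s == w) = false.
    by move=> As; apply: contraNF Nw => /eqP <-.
  by rewrite !zF // !andbF !mulr0 subr0.
apply/subsetP => t; rewrite alternating_components //.
by case/mapP => s _ ->; exact: pv.
Qed.

(** * Types of the faces of a component *)

(** For [(i,j,k,l)], the edge [j -> l] makes face 0 a triangle and is also what makes face 2,
    [(i,j,l)], allowed. If it is missing, [partner] gives another component through [(i,j,l)], whose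
    third vertex completes a square from [j] to [l]. Faces 3 and 1 are related in the same way. *)
Lemma face_types v p : in_Omega3 e xi v -> p \in components v ->
  type2 e (face 0 p) = (if allowed e (sface false p) then tT else tS) /\
  type2 e (face 3%:R p) = (if allowed e (sface true p) then tT else tS).
Proof.
move=> Ov pv; have Ap := Ov.1 _ pv; have part b := @partner v p b Ov pv.
have [x [y [z [s pE]]]] := tuple4P p; rewrite {}pE in pv Ap part *.
move: Ap; rewrite allowed4E => /and3P[exy eyz ezs].
have partE q : q \in components v -> exists x' y' z' s',
    [/\ q = [tuple x'; y'; z'; s'], e x' y', e y' z' & e z' s'].
  move=> qv; have [x' [y' [z' [s' qE]]]] := tuple4P q; exists x', y', z', s'.
  by have := Ov.1 _ qv; rewrite qE allowed4E => /and3P[].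
rewrite face0E face3E !type2E exy eyz ezs /=; split.
  rewrite face2E allowed3E exy /=; case: ifPn => // eys.
  have := part false; rewrite face2E allowed3E exy => /(_ eys)[q []].
  case/partE=> x' [y' [z' [s' [-> _ eyz' ezs']]]].
  rewrite face2E => ne /tuple3_inj[eqx eqy eqs]; subst x' y' s'.
  rewrite ifT //; apply/existsP; exists z'; rewrite eyz' ezs' !andbT.
  by apply: contraNneq ne => ->.
rewrite face1E allowed3E ezs andbT; case: ifPn => // exz.
have := part true; rewrite face1E allowed3E ezs andbT => /(_ exz)[q []].
case/partE=> x' [y' [z' [s' [-> exy' eyz' _]]]].
rewrite face1E => ne /tuple3_inj[eqx eqz eqs]; subst x' z' s'.
rewrite ifT //; apply/existsP; exists y'; rewrite exy' eyz' !andbT.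
by apply: contraNneq ne => ->.
Qed.

(** When the ends are not joined by an edge, two allowed 2-paths with different middles are each the
    square witness of the other. *)
Lemma type2_middle x y y' z : allowed e [tuple x; y; z] -> allowed e [tuple x; y'; z] ->
  type2 e [tuple x; y; z] = type2 e [tuple x; y'; z] /\
  (y != y' -> type2 e [tuple x; y; z] <> tW).
Proof.
rewrite !type2E !allowed3E; have [->|yy'] := eqVneq y y'; first by [].
move=> /[dup] => + /andP[exy eyz] /[dup] + /andP[exy' eyz'] => -> -> /=.
case: ifP => // _.
have -> : [exists t, [&& t != y, e x t & e t z]].
  by apply/existsP; exists y'; rewrite exy' eyz' eq_sym yy'.
have -> : [exists t, [&& t != y', e x t & e t z]].
  by apply/existsP; exists y; rewrite exy eyz yy'.
by [].
Qed.

(** * Trapezohedra from closed walks *)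

Definition trap (x y : V) r (j k : 'I_r -> V) : paths C V 3 :=
  \sum_(t < r) (elem C [tuple x; j t; k t; y] - elem C [tuple x; j (ordS t); k t; y]).

(** Face 1 forgets the [j] vertex, so the two terms of index [t] cancel; face 2 forgets the [k]
    vertex, and the terms cancel after the cyclic shift of [t]. *)
Lemma nsum_trap x y r (j k : 'I_r -> V) b w : nsum (trap x y j k) b w = 0.
Proof.
have elem1 p : nsum (elem C p) b w = (sface b p == w)%:R.
  by rewrite -[elem C p]scale1r nsum_elem mul1r.
rewrite /trap sumrB nsumD -scaleN1r.
have -> u : nsum (-1 *: u) b w = - nsum u b w.
  by rewrite /nsum -sumrN; apply: eq_bigr => t _; rewrite scale_pathE mulN1r.
rewrite !nsum_sum; under eq_bigr do rewrite elem1.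
under [X in _ - X]eq_bigr do rewrite elem1.
case: b {elem1}.
  under eq_bigr do rewrite face1E.
  by under [X in _ - X]eq_bigr do rewrite face1E; exact: subrr.
under eq_bigr do rewrite face2E; under [X in _ - X]eq_bigr do rewrite face2E.
apply/eqP; rewrite subr_eq0; apply/eqP.
by rewrite (reindex_inj (@ordS_inj r)).
Qed.

Lemma ordS_neq r (t : 'I_r) : (2 <= r)%N -> ordS t != t.
Proof.
move=> r2; rewrite -val_eqE /=; have [lt|] := ltnP t.+1 r.
  by rewrite modn_small ?(gtn_eqF (ltnSn _)) // .
move=> ge; have -> : t.+1 = r by apply/eqP; rewrite eqn_leq ge ltn_ord.
by rewrite modnn; lia.
Qed.

(** Under these hypotheses the [2r] paths are pairwise distinct, so no coefficients merge. *)
Lemma trapE x y r (j k : 'I_r -> V) (t : 'I_r) : (2 <= r)%N -> injective j -> injective k ->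
  trap x y j k [tuple x; j t; k t; y] = 1 /\
  trap x y j k [tuple x; j (ordS t); k t; y] = -1.
Proof.
move=> r2 jinj kinj; rewrite /trap !sum_ffunE; split; rewrite (bigD1 t) //= big1 ?addr0.
- rewrite !ffunE eqxx; case: eqP => [/tuple4_inj[_ /jinj/esym/eqP]|_].
    by rewrite (negPf (ordS_neq _ _)).
  by rewrite subr0.
- move=> i it; rewrite !ffunE; do 2![case: eqP => [/tuple4_inj[_ _ /kinj/eqP]|_];
    first by rewrite eq_sym (negPf it)].
  by rewrite subr0.
- rewrite !ffunE (eqxx [tuple x; j (ordS t); k t; y]).
  case: eqP => [/tuple4_inj[_ /jinj/eqP]|_].
    by rewrite (negPf (ordS_neq _ _)).
  by rewrite sub0r.
- move=> i it; rewrite !ffunE; do 2![case: eqP => [/tuple4_inj[_ _ /kinj/eqP]|_];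
    first by rewrite eq_sym (negPf it)].
  by rewrite subr0.
Qed.

Lemma trap_components x y r (j k : 'I_r -> V) q : q \in components (trap x y j k) ->
  exists t : 'I_r, q = [tuple x; j t; k t; y] \/ q = [tuple x; j (ordS t); k t; y].
Proof.
rewrite inE => /eqP qn; have [t /orP qt|nt] := pickP
  [pred t : 'I_r | (q == [tuple x; j t; k t; y]) || (q == [tuple x; j (ordS t); k t; y])].
  by exists t; case: qt => /eqP ->; [left | right].
case: qn; rewrite /trap sum_ffunE big1 // => t _.
by have /= /norP[/negPf qa /negPf qb] := negbT (nt t); rewrite !ffunE qa qb subr0.
Qed.

Lemma cluster_tuple (v : paths C V 3) : cluster v -> exists x y,
  forall p, p \in components v -> p = [tuple x; tnth p 1; tnth p 2%:R; y].
Proof.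
case=> x [y vxy]; exists x, y => p /vxy; have [i [j [k [l ->]]]] := tuple4P p.
by rewrite /thead !(tnth_nth i) /= => -[-> ->].
Qed.

Lemma has_type7 v p : in_Omega3 e xi v -> p \in components v ->
  (forall b, ~~ allowed e (sface b p)) -> has_type e 7 p.
Proof.
move=> Ov pv Np; apply/(has_typeE (n := 7) _ erefl).
have [-> ->] := face_types Ov pv; rewrite !(negPf (Np _)).
by split=> //; apply/type2N.
Qed.

(** The components from [r] to [n.-1] form a cycle that alternates between the two families of paths
    of a trapezohedron. Its sum lies in Omega, so by minimality [v] is a multiple of it. *)
Lemma walk_trapezohedron v b (p : nat -> 4.-tuple V) r n :
  minimal e xi v -> cluster v -> walk v b p ->
  (0 < r < n)%N -> node b p r = node b p n ->
  (forall s, (0 < s < n)%N -> ~~ allowed e (node b p s)) ->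
  {in [pred s | (0 < s < n)%N] &, injective (node b p)} ->
  trapezohedron e v.
Proof.
move=> vmin vab wp rn zrn Nz zinj; have [Ov _ _] := vmin.
have [pv share move_on] := wp; have [x [y vxy]] := cluster_tuple vab.
(* Equal non-allowed nodes lie on the same side, so the cycle has even length. *)
have odd_rn : odd n = odd r.
  apply: (can_inj (addKb b)); apply/esym; apply: (sface_side (w := node b p r)).
  - exact: Nz.
  - exact: (Ov.1 _ (pv r)).
  - exact: (Ov.1 _ (pv n)).
  - by [].
  - by rewrite zrn.
pose q := (n - r)./2.
have nr : (n - r)%N = q.*2 by rewrite /q; lia.
have q2 : (2 <= q)%N.
  (* In a cycle of length 2 the two components would share both interior faces and coincide. *)
  have q1 : q <> 1%N.
    move=> q1; have nE : n = r.+2 by lia.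
    have /move_on/eqP[] : ~~ allowed e (node b p r.+1) by apply: Nz; lia.
    apply: sface_inj => b'; have [->|b'E] := eqVneq b' (b (+) odd r.+1).
      exact: share.
    have -> : b' = b (+) odd r.
      by rewrite oddS addbN in b'E; case: (b') (b (+) odd r) b'E => -[].
    rewrite -/(node b p r) zrn nE /node /=.
    by have := share r.+1; rewrite /= negbK => ->.
  by lia.
(* Periodic extension of the cycle. The walk itself need not be periodic: [p n] may differ from
   [p r], only their nodes agree. *)
pose P i := p (r + i %% q.*2)%N.
pose side i := b (+) odd (r + i).
have mod_odd i : odd (i %% q.*2) = odd i.
  by rewrite [in RHS](divn_eq i q.*2) oddD oddM odd_double andbF.
have nodeP i : sface (side i) (P i) = node b p (r + i %% q.*2)%N.
  by rewrite /node /side !oddD mod_odd.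
have shareP i : sface (side i.+1) (P i) = sface (side i.+1) (P i.+1).
  rewrite nodeP /P modnS; case: ifP => [dv|_]; last first.
    rewrite addnS /node -share /side; congr (sface (b (+) _) _).
    by rewrite addnS !oddS !oddD mod_odd.
  (* The wrap-around: the last component of the cycle is left through the node at [n], which is the
     node at [r]. *)
  have im : (i %% q.*2).+1 = q.*2.
    have := modnS i q.*2; rewrite dv => im0.
    have : (i.+1 %% q.*2 = (i %% q.*2).+1 %% q.*2)%N by rewrite -addn1 -modnDml addn1.
    rewrite im0; have : (i %% q.*2 < q.*2)%N by rewrite ltn_mod; lia.
    rewrite leq_eqVlt => /orP[/eqP //|lt]; rewrite modn_small //.
  rewrite addn0 zrn; have -> : n = (r + i %% q.*2).+1 by lia.
  rewrite /node -share /side; congr (sface (b (+) _) _).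
  by rewrite addnS !oddS !oddD mod_odd.
have Pv i : P i \in components v by exact: pv.
have NP i : ~~ allowed e (node b p (r + i %% q.*2)).
  have : (i %% q.*2 < q.*2)%N by rewrite ltn_mod; lia.
  by move=> ?; apply: Nz; lia.
have NPb b' i : ~~ allowed e (sface b' (P i)).
  have [->|b'E] := eqVneq b' (side i); first by rewrite nodeP.
  have -> : b' = side i.+1.
    move: b'E; by rewrite /side addnS oddS addbN; case: b' (b (+) _) => -[].
  by rewrite shareP nodeP.
have nodeP_inj i i' : node b p (r + i %% q.*2) = node b p (r + i' %% q.*2) ->
    i = i' %[mod q.*2].
  have : (i %% q.*2 < q.*2)%N by rewrite ltn_mod; lia.
  have : (i' %% q.*2 < q.*2)%N by rewrite ltn_mod; lia.
  by move=> ? ? /zinj; rewrite !inE => E; apply: (@addnI r); apply: E; lia.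
(* The offset, 0 or 1, after which even positions are entered through face 2 and left through face
   1. *)
pose d : nat := b (+) odd r.
have sideA (t : nat) : side (t.*2 + d)%N = false.
  by rewrite /side !oddD odd_double /d oddb; case: (b) (odd r) => -[].
have sideB (t : nat) : side (t.*2 + d).+1 = true.
  by rewrite /side addnS oddS addbN -/(side _) sideA.
pose j (t : 'I_q) := tnth (P (t.*2 + d)%N) 1.
pose k (t : 'I_q) := tnth (P (t.*2 + d)%N) 2%:R.
have AE (t : 'I_q) : P (t.*2 + d)%N = [tuple x; j t; k t; y] by rewrite -vxy.
(* An odd position shares face 1, hence its [k] vertex, with its predecessor, and face 2, hence its
   [j] vertex, with its successor. *)
have BE (t : 'I_q) : P (t.*2 + d).+1 = [tuple x; j (ordS t); k t; y].
  have := shareP (t.*2 + d)%N; rewrite sideB AE face1E (vxy _ (Pv (t.*2 + d).+1)) face1E.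
  case/tuple3_inj => _ <- _.
  have := shareP (t.*2 + d).+1.
  have -> : (t.*2 + d).+2 = (t.+1.*2 + d)%N by rewrite doubleS.
  have -> : P (t.+1.*2 + d)%N = P ((ordS t).*2 + d)%N.
    by rewrite /P /= -modnDml -(modnDml (_ .*2)) -!muln2 -!muln_modl !modn_mod.
  by rewrite sideA AE (vxy _ (Pv (t.*2 + d).+1)) !face2E => /tuple3_inj[_ -> _].
have double_mod_inj (t t' : 'I_q) : (t.*2 + d)%N = (t'.*2 + d)%N %[mod q.*2] -> t = t'.
  move/eqP; rewrite eqn_modDr !modn_small ?ltn_double // => /eqP/double_inj.
  exact: val_inj.
(* With the ends fixed, [j t] determines face 2 and [k t] determines face 1; both are nodes of the
   cycle, which are distinct. *)
have jinj : injective j.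
  move=> t t' jt; apply: double_mod_inj; apply: nodeP_inj.
  by rewrite -!nodeP !sideA !AE !face2E jt.
have kinj : injective k.
  move=> t t' kt; apply: double_mod_inj; apply/eqP.
  rewrite -(eqn_modDr 1) !addn1; apply/eqP; apply: nodeP_inj.
  by rewrite -!nodeP !sideB !BE !face1E kt.
have uv : components (trap x y j k) \subset components v.
  by apply/subsetP => t /trap_components[s [->|->]]; rewrite -?AE -?BE.
have Ou : in_Omega3 e xi (trap x y j k).
  by apply: in_Omega3_sub Ov uv _ => *; exact: nsum_trap.
have u0 : trap x y j k != 0.
  have q0 : (0 < q)%N by lia.
  apply/eqP => /ffunP/(_ [tuple x; j (Ordinal q0); k (Ordinal q0); y]) /eqP.
  by rewrite (trapE _ _ _ q2 jinj kinj).1 ffunE oner_eq0.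
have [c c0 vE] := minimal_proportional vmin u0 Ou uv.
exists q, x, y, j, k, c; split=> //.
  by apply/ffunP => t; rewrite scale_pathE vE.
move=> t tv; apply: (has_type7 Ov tv).
have: t \in components (trap x y j k).
  by move: tv; rewrite !inE vE mulf_eq0 (negPf c0).
by case/trap_components=> s [->|->] b'; rewrite -?AE -?BE.
Qed.

(** * Walks between allowed faces: chains and isolated components *)

Lemma one_step_sface v p q b : in_Omega3 e xi v -> p \in components v ->
  q \in components v -> p != q -> ~~ allowed e (sface b p) -> sface b q = sface b p ->
  v p + v q = 0 -> one_step e xi v p q (sface b p).
Proof.
move=> Ov pv qv pq Nw qw vpq; split=> //; first exact/type2N.
- by exists (if b then 1 else 2%:R).
- by exists (if b then 1 else 2%:R).
have Ap := Ov.1 _ pv; have Aq := Ov.1 _ qv.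
have cancel b' : nsum (v p *: elem C p + v q *: elem C q) b' (sface b p) = 0.
  rewrite nsumD !nsum_elem; have [->|bb'] := eqVneq b' b.
    by rewrite qw eqxx !mulr1.
  have F r : allowed e r -> (sface b' r == sface b p) = false.
    move=> Ar; apply/negP => /eqP rp; case/eqP: bb'.
    exact: sface_side Nw Ar Ap rp erefl.
  by rewrite !F // !mulr0 addr0.
rewrite boundary_nsum ?cancel ?mulr0 ?addr0 // => t.
rewrite inE; apply: contraR => Nt.
have tF r : allowed e r -> (t == r) = false by move=> Ar; apply: contraNF Nt => /eqP->.
by rewrite ffunE !scale_pathE !elemE !tF // !mulr0 addr0.
Qed.

(** The number of the gamma type of a chain end, read from its allowed interior face; 0 is a dummy
    value. *)
Definition end_index (x : ptype) : nat :=
  match x with tT => 1 | tS => 2 | tW => 3 | tN => 0 end.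

(** The side [b] of the allowed face separates [gamma_1] to [gamma_3] (face 1) from their mirror
    images [gamma_4] to [gamma_6] (face 2). *)
Definition end_type b (i : nat) : nat := if b then i else i + 3.

Lemma has_type_end v p b : in_Omega3 e xi v -> p \in components v ->
  allowed e (sface b p) -> ~~ allowed e (sface (~~ b) p) ->
  has_type e (end_type b (end_index (type2 e (sface b p)))) p.
Proof.
move=> Ov pv Ab Nb; have [t0 t3] := face_types Ov pv.
have NW : type2 e (sface b p) <> tN by move/type2N; rewrite Ab.
case: b Ab Nb NW => /= Ab Nb NW; rewrite Ab (negPf Nb) in t0 t3;
case Et: (type2 e (sface _ p)) NW => // _; rewrite /end_type /end_index.
- by apply/(has_typeE (n := 1) _ erefl); split=> //; apply/type2N.
- by apply/(has_typeE (n := 2) _ erefl); split=> //; apply/type2N.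
- by apply/(has_typeE (n := 3) _ erefl); split=> //; apply/type2N.
- by apply/(has_typeE (n := 4) _ erefl); split=> //; apply/type2N.
- by apply/(has_typeE (n := 5) _ erefl); split=> //; apply/type2N.
- by apply/(has_typeE (n := 6) _ erefl); split=> //; apply/type2N.
Qed.

Lemma sface_middle b (x j k y : V) :
  sface b [tuple x; j; k; y] = [tuple x; if b then k else j; y].
Proof. by case: b; rewrite (face1E, face2E). Qed.

(** The last component has its allowed face on side [b (+) odd m], which gives the parity rule. Both
    allowed end faces run from [x] to [y], so they have the same type and the index [i] is common to
    the two ends. *)
Lemma walk_chain v b (p : nat -> 4.-tuple V) m :
  minimal e xi v -> cluster v -> walk v b p ->
  allowed e (node b p 0) -> allowed e (node b p m.+2) ->
  (forall s, (0 < s < m.+2)%N -> ~~ allowed e (node b p s)) ->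
  {in [pred s | (0 < s < m.+2)%N] &, injective (node b p)} ->
  exists i : nat, [/\ [\/ i = 1%N, i = 2%N | i = 3%N /\ (0 < m)%N] &
    gamma7_chain e xi v (end_type b i) m (end_type (b (+) odd m) i)].
Proof.
move=> vmin vab wp A0 An Nz zinj; have [Ov _ _] := vmin.
have [pinj [c c0 vE]] := walk_alternating vmin wp (ltn0Sn _) A0 An Nz zinj.
have [pv share move_on] := wp; have [x [y vxy]] := cluster_tuple vab.
have nodeS s : node b p s.+1 = sface (b (+) odd s.+1) (p s) by rewrite share.
have sideE s : b (+) odd s.+1 = ~~ (b (+) odd s) by rewrite oddS addbN.
have NW s : (s < m.+1)%N -> ~~ allowed e (node b p s.+1) by move=> sm; apply: Nz; lia.
have endE : sface (b (+) odd m) (p m.+1) = node b p m.+2.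
  by rewrite nodeS /= negbK.
have mid b' q : q \in components v -> exists z, sface b' q = [tuple x; z; y].
  by move=> /vxy ->; rewrite sface_middle; eexists.
have [z0 Ez0] := mid b (p 0%N) (pv _); have [z1 Ez1] := mid (b (+) odd m) (p m.+1) (pv _).
have node0 : node b p 0 = sface b (p 0%N) by rewrite /node addbF.
have type_eq : type2 e (sface (b (+) odd m) (p m.+1)) = type2 e (sface b (p 0%N)).
  have A1 := An; rewrite -endE Ez1 in A1; have A2 := A0; rewrite node0 Ez0 in A2.
  by rewrite Ez0 Ez1; have [] := type2_middle A1 A2.
exists (end_index (type2 e (sface b (p 0%N)))); split.
  case Et: (type2 e _) => /=; [by constructor | by constructor 2 | constructor 3 | ].
    (* For [m = 0] the two components share the face on side [~~ b], so their faces on side [b] have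
       different middles: a second allowed 2-path from [x] to [y], which excludes W. *)
    split=> //; case: (posnP m) => // m0; subst m.
    rewrite /= addbF in Ez1 endE.
    have A1 := An; rewrite -endE Ez1 in A1; have A2 := A0; rewrite node0 Ez0 in A2.
    have [_ W] := type2_middle A2 A1; case: W; last by rewrite -Ez0.
    have /move_on : ~~ allowed e (node b p 1) by exact: NW.
    apply: contraNneq => zz; apply/eqP/sface_inj => b'.
    have [->|b'E] := eqVneq b' b; first by rewrite Ez0 Ez1 zz.
    by have := share 0%N; rewrite /= addbT; case: (b) b' b'E => -[].
  by move/type2N: Et; rewrite -node0 A0.
have p0_type : has_type e (end_type b (end_index (type2 e (sface b (p 0%N))))) (p 0%N).
  apply: (has_type_end Ov (pv _)); first by rewrite -node0.
  by have := NW 0%N isT; rewrite nodeS /= addbT.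
have pm_type :
    has_type e (end_type (b (+) odd m) (end_index (type2 e (sface b (p 0%N))))) (p m.+1).
  rewrite -type_eq; apply: (has_type_end Ov (pv _)); first by rewrite endE.
  by have := NW m (ltnSn m); rewrite /node sideE.
split=> //; exists (fun s : 'I_m.+2 => p s), (fun s : 'I_m.+1 => node b p s.+1).
split=> //.
- split=> [s t pst|q]; first by apply: val_inj; apply: pinj; rewrite ?inE ?ltn_ord.
  have -> : (q \in components v) = (q \in components (alternating p m.+2)).
    by rewrite !inE vE mulf_eq0 (negPf c0).
  rewrite alternating_components //; apply/mapP/codomP => [[s]|[s ->]].
    by rewrite mem_iota => /= sm ->; exists (Ordinal sm).
  by exists (val s); rewrite // mem_iota ltn_ord.
- move=> s s0 sm; apply: (has_type7 Ov (pv _)) => b'.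
  have s_pos : (0 < s)%N by rewrite lt0n.
  have s_lt : (s < m.+1)%N by rewrite ltn_neqAle -ltnS ltn_ord andbT.
  have [->|b'E] := eqVneq b' (b (+) odd s); first by apply: Nz; rewrite s_pos ltnW.
  have -> : b' = b (+) odd s.+1.
    by rewrite sideE; case: (b') (b (+) _) b'E => -[].
  by rewrite -nodeS NW.
split=> [s t st|s].
  apply: val_inj; apply: succn_inj; apply: zinj => //; by rewrite inE /= ltnS ltn_ord.
have -> : p (lift ord0 s) = p s.+1 by [].
have -> : p (widen_ord (leqnSn m.+1) s) = p s by [].
rewrite nodeS; apply: one_step_sface => //.
- by apply: move_on; rewrite -share -nodeS NW.
- by rewrite -nodeS NW.
have sm := ltn_ord s.
by rewrite !vE !alternatingE //; [rewrite exprS mulN1r mulrN subrr | lia].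
Qed.

(** The interior faces are allowed 2-paths with the same ends and with middles joined by an edge,
    hence different. By [type2_middle] they are both triangles or both squares. *)
Lemma isolated_of_allowed v p : in_Omega3 e xi v -> components v = [set p] ->
  (forall b, allowed e (sface b p)) -> isolated e 8 v \/ isolated e 9 v.
Proof.
move=> Ov vp Ap; have pv : p \in components v by rewrite vp set11.
have [t0 t3] := face_types Ov pv; rewrite !Ap in t0 t3.
have [x [j [k [y pE]]]] := tuple4P p.
have /and3P[_ ejk _] : [&& e x j, e j k & e k y] by rewrite -allowed4E -pE; apply: Ov.1.
have := Ap true; have := Ap false; rewrite pE !sface_middle => A1 A2.
have [eq_type /(_ (edge_neq ejk)) NW] := type2_middle A1 A2.
have NN : type2 e [tuple x; j; y] <> tN by move/type2N; rewrite A1.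
case Et: (type2 e [tuple x; j; y]) NW NN => // _ _; [right|left]; exists p => //.
- apply/(has_typeE (n := 9) _ erefl); split=> //.
    by rewrite pE sface_middle -eq_type.
  by rewrite pE sface_middle.
- apply/(has_typeE (n := 8) _ erefl); split=> //.
    by rewrite pE sface_middle -eq_type.
  by rewrite pE sface_middle.
Qed.

(** Start a walk at the allowed face. It closes a cycle, or returns to an allowed face after one
    component (isolated type) or after several (chain). *)
Lemma minimal_free v b p0 : minimal e xi v -> cluster v -> p0 \in components v ->
  allowed e (sface b p0) ->
  [\/ isolated e 8 v \/ isolated e 9 v, trapezohedron e v |
      exists i m : nat, [\/ i = 1%N, i = 2%N | i = 3%N /\ (0 < m)%N] /\
        gamma7_chain e xi v (end_type b i) m (end_type (b (+) odd m) i)].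
Proof.
move=> vmin vab p0v A0; have [Ov _ _] := vmin.
have [p pE wp] := walk_exists b Ov p0v.
have {}A0 : allowed e (node b p 0) by rewrite /node pE addbF.
have [n [n0 [An|[r rn zr]] Nz zinj]] := walk_event b p; last first.
  by constructor 2; apply: walk_trapezohedron vmin vab wp rn zr Nz _ => s t; apply: zinj.
have {}zinj : {in [pred s | (0 < s < n)%N] &, injective (node b p)}.
  by move=> s t; apply: zinj.
case: n n0 An Nz zinj => [//|[|m]] _ An Nz zinj; last first.
  by constructor 3; have [i [? ?]] := walk_chain vmin vab wp A0 An Nz zinj; exists i, m.
constructor 1; have [pinj [c c0 vE]] := walk_alternating vmin wp (ltn0Sn _) A0 An Nz zinj.
apply: (@isolated_of_allowed v (p 0%N) Ov).
  apply/setP => q; have -> : (q \in components v) = (q \in components (alternating p 1)).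
    by rewrite !inE vE mulf_eq0 (negPf c0).
  by rewrite alternating_components // !inE.
move=> b'; have [_ share _] := wp.
have [->|b'E] := eqVneq b' b; first by rewrite /node addbF in A0.
have -> : b' = b (+) odd 1 by case: (b') (b) b'E => -[].
by rewrite share.
Qed.

(** * The listed clusters are minimal *)

Definition chain_end i := [|| i == 1, i == 2, i == 3, i == 4, i == 5 | i == 6]%N.

(** No listed type has a non-admissible first or last face, and these two faces contain all three
    edges. Membership in A is thus recovered from the types. *)
Lemma has_type_allowed i t : has_type e i t -> allowed e t.
Proof.
have [x [j [k [y ->]]]] := tuple4P t => ti.
have : type2 e [tuple j; k; y] <> tN /\ type2 e [tuple x; j; k] <> tN.
  move: ti; rewrite /has_type image_typeE face0E face3E.
  by case: i => [//|]; do 9![case=> [[<- _ _ <-] //|]].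
rewrite !type2N !allowed3E allowed4E.
by case=> /negP; rewrite negbK => /andP[-> ->] /negP; rewrite negbK => /andP[-> _].
Qed.

Lemma chain_end_allowed i t : chain_end i -> has_type e i t ->
  exists b, allowed e (sface b t).
Proof.
have [At|/type2N Nt] := boolP (allowed e (sface true t)); first by exists true.
have [At|/type2N Nf] := boolP (allowed e (sface false t)); first by exists false.
rewrite /has_type image_typeE Nt Nf => iend ti; exfalso; move: iend ti.
by case/or4P => [|||/or3P[]] /eqP ->.
Qed.

Lemma has_type7_nonallowed t b : has_type e 7 t -> ~~ allowed e (sface b t).
Proof. by case/(has_typeE (n := 7) _ erefl) => _ Nt Nf _; apply/type2N; case: b. Qed.

Lemma face_sface t w : allowed e t -> ~~ allowed e w ->
  (exists j : 'I_4, face j t = w) -> exists b, sface b t = w.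
Proof.
move=> At Nw [j jw]; have [A0 A3] := allowed_face03 At.
have : [\/ j = 0, j = 1, j = 2%:R | j = 3%:R].
  by case: j {jw} => [[|[|[|[|//]]]] lt];
    [constructor 1 | constructor 2 | constructor 3 | constructor 4]; apply: val_inj.
case=> jE; rewrite jE in jw.
- by rewrite jw (negPf Nw) in A0.
- by exists true.
- by exists false.
- by rewrite jw (negPf Nw) in A3.
Qed.

Lemma nsum_pair u b w p q : p != q -> sface b p = w -> sface b q = w ->
  (forall t, t \in components u -> sface b t = w -> t = p \/ t = q) ->
  nsum u b w = u p + u q.
Proof.
move=> pq pw qw only; rewrite /nsum (bigD1 p) ?pw //= (bigD1 q) /=; last first.
  by rewrite qw eqxx eq_sym.
rewrite big1 ?addr0 // => t /andP[/andP[/eqP tw tp] tq].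
apply/eqP; apply: contraT => ut.
have [|E|E] := only t _ tw; first by rewrite inE.
  by rewrite E eqxx in tp.
by rewrite E eqxx in tq.
Qed.

(** The shared face is interior and, by [sface_side], on the same side of both paths; its boundary
    coefficient is a nonzero power of [xi] times [v p + v q]. *)
Lemma one_stepP v p q w : allowed e p -> allowed e q -> one_step e xi v p q w ->
  [/\ p != q, ~~ allowed e w, v p + v q = 0 & exists2 b, sface b p = w & sface b q = w].
Proof.
move=> Ap Aq [pq /type2N Nw wp wq bd].
have [b pw] := face_sface Ap Nw wp; have [b' qw] := face_sface Aq Nw wq.
have bb' := sface_side Nw Ap Aq pw qw; subst b'.
split=> //; last by exists b.
have Au : in_A e (v p *: elem C p + v q *: elem C q).
  move=> t; rewrite inE; apply: contraR => Nt.
  have tF r : allowed e r -> (t == r) = false by move=> Ar; apply: contraNF Nt => /eqP->.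
  by rewrite ffunE !scale_pathE !elemE !tF // !mulr0 addr0.
move: bd; rewrite boundary_nsum // !nsumD !nsum_elem.
have F r : allowed e r -> (sface (~~ b) r == w) = false.
  move=> Ar; apply/negP => /eqP rw.
  by have := sface_side Nw Ap Ar pw rw; case: (b).
case: b pw qw F => -> -> F; rewrite ?(F p) ?(F q) // eqxx !(mulr0, mulr1, addr0, add0r) => /eqP.
  by rewrite mulf_eq0 (negPf xi_neq0) => /eqP.
by rewrite mulf_eq0 expf_eq0 (negPf xi_neq0) andbF => /eqP.
Qed.

Lemma minimal_connected v : in_Omega3 e xi v -> v != 0 ->
  (forall u, in_Omega3 e xi u -> components u \subset components v -> u != 0 ->
     components v \subset components u) -> minimal e xi v.
Proof.
move=> Ov v0 conn; split=> // u u0 /properP[uv [t tv tu]] Ou.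
by case/negP: tu; apply: (subsetP (conn u Ou uv u0)).
Qed.

(** Each shared face meets exactly two components, and there are no other non-allowed faces. An
    element of Omega supported in [v] therefore alternates along the chain and, if nonzero, has full
    support. *)
Lemma chain_minimal v i m j : chain_end i -> chain_end j ->
  gamma7_chain e xi v i m j -> minimal e xi v /\ cluster v.
Proof.
move=> iend jend [vab [p0 [w0 [[pinj vE] ti t7 tj [winj steps]]]]]; split=> //.
(* Natural number indices ease the induction; out of range, [inord] falls back to 0. *)
pose p s := p0 (inord s); pose w s := w0 (inord s).
have p_ord (s : 'I_m.+2) : p0 s = p s by rewrite /p inord_val.
have typed s : exists k, has_type e k (p0 s).
  have [->|s0] := eqVneq s ord0; first by exists i.
  by have [->|sm] := eqVneq s ord_max; [exists j | exists 7; apply: t7].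
have Ap s : allowed e (p s) by have [k /has_type_allowed] := typed (inord s).
have step s : (s <= m)%N -> [/\ p s != p s.+1, ~~ allowed e (w s),
    v (p s) + v (p s.+1) = 0 & exists2 b, sface b (p s) = w s & sface b (p s.+1) = w s].
  move=> sm; apply: one_stepP => //; have := steps (inord s).
  rewrite !p_ord /= inordK //.
have w_inj (s t : nat) : (s <= m)%N -> (t <= m)%N -> w s = w t -> s = t.
  by move=> sm tm /winj/(congr1 val); rewrite /= !inordK.
(* A non-allowed interior face is shared with a neighbour: an end component has just one, as its
   other interior face is allowed. *)
have near s b : (s <= m.+1)%N -> ~~ allowed e (sface b (p s)) ->
    (s <= m)%N /\ sface b (p s) = w s \/ (0 < s)%N /\ sface b (p s) = w s.-1.
  move=> sm Nb; have [s0|s0] := posnP s.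
    subst s; left; split=> //; have [_ N0 _ [b1 E1 _]] := step 0%N isT.
    have [b2 A2] := chain_end_allowed iend ti.
    have pE : p 0%N = p0 ord0 by congr p0; apply: val_inj; rewrite /= inordK.
    rewrite -pE in A2; rewrite -E1 in N0 *; congr (sface _ (p 0%N)).
    by case: b b1 b2 Nb N0 A2 {E1} => -[] [] // A B D; rewrite ?D // in A B.
  have [_ N1 _ [b1 _ E1]] := step s.-1 ltac:(lia); rewrite prednK // in E1.
  have [->|bb1] := eqVneq b b1; first by right.
  left; have [sm1|] := leqP s m; last first.
    move=> ms; have sE : s = m.+1 by lia.
    have [b2 A2] := chain_end_allowed jend tj.
    have pE : p s = p0 ord_max by congr p0; apply: val_inj; rewrite /= inordK.
    rewrite -pE in A2; rewrite -E1 in N1.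
    by case: b b1 b2 bb1 Nb N1 A2 {E1} => -[] [] // _ A B D; rewrite ?D // in A B.
  split=> //; have [_ _ _ [b2 E2 _]] := step s sm1; rewrite -E2; congr (sface _ (p s)).
  (* On the same side, the shared faces before and after [p s] would coincide, against injectivity
     of [w]. *)
  have : b2 != b1.
    apply/eqP => bE; have := w_inj s s.-1 sm1 ltac:(lia).
    by rewrite -E1 -E2 bE => /(_ erefl); lia.
  by case: b b1 b2 bb1 {Nb E1 E2} => -[] [].
have vP q : q \in components v -> exists2 s, (s <= m.+1)%N & q = p s.
  by rewrite vE => /codomP[s ->]; exists s => //; rewrite -ltnS ltn_ord.
have pv s : p s \in components v by rewrite vE codom_f.
have pair s : (s <= m)%N -> exists b, sface b (p s) = w s /\
    forall u, components u \subset components v -> nsum u b (w s) = u (p s) + u (p s.+1).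
  move=> sm; have [pq Nw _ [b E1 E2]] := step s sm; exists b; split=> // u uv.
  apply: nsum_pair => // t /(subsetP uv)/vP[t' t'm ->] t'w.
  have Nt : ~~ allowed e (sface b (p t')) by rewrite t'w.
  case: (near t' b t'm Nt) => -[t'0]; rewrite t'w => /w_inj E.
    by left; rewrite E.
  by right; rewrite (E sm) ?prednK //; lia.
have Av : in_A e v by move=> t /vP[s _ ->].
have Ov : in_Omega3 e xi v.
  apply/in_Omega3P => // b w' Nw'.
  have [t /andP[/vP[s sm ->] /eqP sw]|nt] :=
    pickP [pred t | (t \in components v) && (sface b t == w')]; last first.
    by apply: nsum_eq0 => t tv; have /= := nt t; rewrite tv /= => ->.
  have [r [rm wr]] : exists r, (r <= m)%N /\ w' = w r.
    rewrite -sw in Nw' *; case: (near s b sm Nw') => -[? ->]; first by exists s.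
    by exists s.-1; split=> //; lia.
  have [b' [E S]] := pair r rm; have [_ _ vr _] := step r rm.
  have -> : b = b' by apply: sface_side Nw' (Ap s) (Ap r) sw _; rewrite wr.
  by rewrite wr S.
have v0 : v != 0.
  by apply/eqP => v0; have := pv 0%N; rewrite inE v0 ffunE eqxx.
apply: minimal_connected => // u Ou uv u0; have [q qu] := components_neq0 u0.
have alt s : (s <= m.+1)%N -> u (p s) = (-1) ^+ s * u (p 0%N).
  elim: s => [|s IH] sm; first by rewrite mul1r.
  have [b [_ /(_ u uv)]] := pair s sm; have [_ Nw _ _] := step s sm.
  have /in_Omega3P -> // := Ou; last exact: Ou.1.
  rewrite addrC => /esym/eqP; rewrite addr_eq0 => /eqP ->.
  by rewrite IH 1?ltnW // exprS mulN1r mulNr.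
have u00 : u (p 0%N) != 0.
  have [s sm qE] := vP q (subsetP uv q qu).
  by move: qu; rewrite inE qE alt // mulf_eq0 signr_eq0.
by apply/subsetP => t /vP[s sm ->]; rewrite inE alt // mulf_neq0 // signr_eq0.
Qed.

(** All interior faces are non-allowed, and each meets two components. The conditions at faces 1 and
    2 force any [u] in Omega supported in [v] to be constant on the [A t] and opposite on the [B t],
    so a nonzero [u] has full support. *)
Lemma trapezohedron_minimal v : trapezohedron e v -> minimal e xi v /\ cluster v.
Proof.
case=> r [x [y [j [k [c [r2 [jinj kinj] c0 vE t7]]]]]].
have {}vE : v = c *: trap x y j k by [].
have comp_v q : (q \in components v) = (q \in components (trap x y j k)).
  by rewrite !inE vE scale_pathE mulf_eq0 (negPf c0).
pose A (t : 'I_r) := [tuple x; j t; k t; y]; pose B (t : 'I_r) := [tuple x; j (ordS t); k t; y].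
have compP q : q \in components v -> exists t : 'I_r, q = A t \/ q = B t.
  by rewrite comp_v => /trap_components.
have Av (t : 'I_r) : A t \in components v.
  by rewrite comp_v inE (trapE _ _ _ r2 jinj kinj).1 oner_eq0.
have Bv (t : 'I_r) : B t \in components v.
  by rewrite comp_v inE (trapE _ _ _ r2 jinj kinj).2 oppr_eq0 oner_eq0.
have Na q b : q \in components v -> ~~ allowed e (sface b q).
  by move=> qv; apply/has_type7_nonallowed/t7.
split; last by exists x, y => q /compP[t [] ->]; rewrite /thead !(tnth_nth x).
have Ov : in_Omega3 e xi v.
  apply/in_Omega3P => [q qv|b w _]; first exact: has_type_allowed (t7 q qv).
  have -> : nsum v b w = c * nsum (trap x y j k) b w.
    by rewrite /nsum mulr_sumr; apply: eq_bigr => q _; rewrite vE scale_pathE.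
  by rewrite nsum_trap mulr0.
have r0 : (0 < r)%N by lia.
have v0 : v != 0.
  by apply/eqP => v0; have := Av (Ordinal r0); rewrite inE v0 ffunE eqxx.
have AB (t t' : 'I_r) : A t = B t' -> False.
  case/tuple4_inj=> _ jt /kinj tt _; subst t'.
  by have := ordS_neq t r2; rewrite -(jinj _ _ jt) eqxx.
apply: minimal_connected => // u Ou uv u0; have [q qu] := components_neq0 u0.
have sums (t : 'I_r) : u (A t) + u (B t) = 0 /\ u (B t) + u (A (ordS t)) = 0.
  have nsum0 b (s : 4.-tuple V) : s \in components v -> nsum u b (sface b s) = 0.
    by move=> sv; apply: ((in_Omega3P Ou.1).1 Ou); exact: Na.
  split.
    rewrite -(nsum0 true (A t)) //; apply/esym/nsum_pair => //.
    - by apply/eqP => /AB.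
    - by rewrite !face1E.
    move=> s /(subsetP uv)/compP[t' [] ->]; rewrite !face1E => /tuple3_inj[_ /kinj -> _];
      by [left | right].
  rewrite -(nsum0 false (B t)) //; apply/esym/nsum_pair => //.
  - by apply/eqP => /esym/AB.
  - by rewrite !face2E.
  move=> s /(subsetP uv)/compP[t' [] ->]; rewrite !face2E => /tuple3_inj[_ /jinj].
    by move=> -> _; right.
  by move=> /ordS_inj -> _; left.
have A_const (t : 'I_r) : u (A t) = u (A (Ordinal r0)).
  case: t => n nr; elim: n nr => [|n IH] nr; first by congr (u (A _)); apply: val_inj.
  have -> : Ordinal nr = ordS (Ordinal (ltnW nr)).
    by apply: val_inj; rewrite /= modn_small.
  have [/eqP S1 /eqP S2] := sums (Ordinal (ltnW nr)).
  by rewrite -(IH (ltnW nr)); move: S1 S2; rewrite addr_eq0 addrC addr_eq0 => /eqP -> /eqP ->.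
have BE (t : 'I_r) : u (B t) = - u (A (Ordinal r0)).
  by have [/eqP] := sums t; rewrite addrC addr_eq0 A_const => /eqP.
have A0 : u (A (Ordinal r0)) != 0.
  have [t qt] := compP q (subsetP uv q qu).
  by move: qu; rewrite inE; case: qt => ->; rewrite ?BE ?oppr_eq0 // A_const.
by apply/subsetP => s /compP[t [] ->]; rewrite inE ?BE ?oppr_eq0 // A_const.
Qed.

Lemma isolated_minimal v i : (i == 8) || (i == 9) -> isolated e i v ->
  minimal e xi v /\ cluster v.
Proof.
move=> i89 [p vp pi]; have Ap := has_type_allowed pi.
have pv : p \in components v by rewrite vp set11.
have Ab b : allowed e (sface b p).
  apply: contraT => /type2N Nb; move: i89 pi; rewrite /has_type image_typeE.
  by case/orP => /eqP ->; case: b Nb => ->.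
have Av : in_A e v by move=> t; rewrite vp => /set1P ->.
split; last first.
  by exists (thead p), (tnth p ord_max) => t; rewrite vp => /set1P ->.
apply: minimal_connected.
- apply/in_Omega3P => // b w Nw; apply: nsum_eq0 => t; rewrite vp => /set1P ->.
  by apply: contraNneq Nw => <-.
- by apply/eqP => v0; rewrite inE v0 ffunE eqxx in pv.
move=> u _ uv /components_neq0[q qu].
by have := subsetP uv q qu; rewrite vp sub1set => /set1P <-.
Qed.

(** * The classification *)

(** Starting at an allowed face 1 whenever there is one orients the odd chains from [i] to [i + 3].
    If no interior face is allowed, a walk can only close up, giving a trapezohedron. *)
Lemma minimal_cases v : minimal e xi v -> cluster v ->
  [\/ isolated e 8 v \/ isolated e 9 v, trapezohedron e v |
      exists i m : nat, [\/ i = 1%N, i = 2%N | i = 3%N /\ (0 < m)%N] /\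
        if odd m then gamma7_chain e xi v i m (i + 3)
        else gamma7_chain e xi v i m i \/ gamma7_chain e xi v (i + 3) m (i + 3)].
Proof.
move=> vmin vab; have [Ov v0 _] := vmin; have [p0 p0v] := components_neq0 v0.
have [p /andP[pv Ap]|none1] :=
  pickP [pred p | (p \in components v) && allowed e (sface true p)].
  have [?|?|[i [m [i_m ch]]]] := minimal_free vmin vab pv Ap;
    [by constructor 1 | by constructor 2 | constructor 3].
  by exists i, m; split=> //; move: ch; rewrite /end_type addTb; case: (odd m) => //=; left.
have [p /andP[pv Ap]|none2] :=
  pickP [pred p | (p \in components v) && allowed e (sface false p)].
  have [?|?|[i [m [i_m ch]]]] := minimal_free vmin vab pv Ap;
    [by constructor 1 | by constructor 2 | constructor 3].
  exists i, m; split=> //; move: ch; rewrite /end_type addFb.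
  case: (odd m) => /= [ch|]; last by right.
  (* The last component of such a chain would have an allowed face 1. *)
  have [_ [q [w [[_ vE] _ _ tq _]]]] := ch.
  have := none1 (q ord_max); rewrite /= vE codom_f /= => /negbT/type2N Nq.
  by move: tq; rewrite /has_type image_typeE Nq; case: i_m {ch} => [->|->|[-> _]].
have [p _ wp] := walk_exists true Ov p0v; have [pv _ _] := wp.
have Nz s : ~~ allowed e (node true p s).
  have := none1 (p s); have := none2 (p s); rewrite /= pv /= => /negbT N2 /negbT N1.
  by rewrite /node; case: (_ (+) _).
have [n [n0 [An|[r rn zr]] Nz' zinj]] := walk_event true p.
  by have := Nz n; rewrite An.
by constructor 2; apply: walk_trapezohedron vmin vab wp rn zr Nz' _ => s t; apply: zinj.
Qed.

End Paths3.

(* For even m the two ends of a chain have equal types; the chains whose ends   *)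
(* are both gamma_(i+3) are the mirror images (reversed paths, reversed edges)  *)
(* of the chains whose ends are both gamma_i, and both occur.                   *)
Theorem corollary3p8p1 (R : realType) (N : nat) (xi : R[i])
    (V : finType) (e : rel V) (v : paths R[i] V 3) :
  (2 <= N)%N -> N.-primitive_root xi -> simple_digraph e ->
  (minimal e xi v /\ cluster v) <->
  [\/ exists i m : nat, (i = 1 \/ i = 2)%N /\
        if odd m then gamma7_chain e xi v i m (i + 3)
        else gamma7_chain e xi v i m i \/ gamma7_chain e xi v (i + 3) m (i + 3),
      exists i m : nat, i = 3%N /\
        if odd m then gamma7_chain e xi v i m (i + 3)
        else (2 <= m)%N /\ (gamma7_chain e xi v i m i \/
                            gamma7_chain e xi v (i + 3) m (i + 3)),
      trapezohedron e v |
      isolated e 8 v \/ isolated e 9 v].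
Proof.
move=> N2 xiN simple_e.
have xi0 : xi != 0.
  apply/eqP => xi0; have := prim_expr_order xiN.
  by rewrite xi0 expr0n gtn_eqF ?(leq_trans _ N2) // => /esym/eqP; rewrite oner_eq0.
have chainP := @chain_minimal _ V e simple_e xi xi0 v.
split=> [[vmin vab]|].
  have [?|?|[i [m [im ch]]]] := minimal_cases simple_e xi0 vmin vab.
  - by constructor 4.
  - by constructor 3.
  case: im ch => [->|->|[-> m0]] ch; [constructor 1 | constructor 1 | constructor 2].
  - by exists 1%N, m; split=> //; left.
  - by exists 2%N, m; split=> //; right.
  by exists 3%N, m; split=> //; case: ifP ch => // odd_m ch; split=> //; lia.
case=> [[i [m [i12]]]|[i [m [->]]]|/(trapezohedron_minimal simple_e xi0) //|].
- by case: i12 => ->; case: ifP => _ => [|[]]; apply: chainP.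
- by case: ifP => _ => [|[_ []]]; apply: chainP.
by case; apply: (isolated_minimal simple_e xi0).
Qed.
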